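(* Let $m\geq 2$ be an integer and let $F\in\mathbb{Z}[x_1,\dots,x_n]$ be a homogeneous polynomial of degree $k\geq 2$. Suppose that every $\mathbf{x}\in\mathbb{Z}^n$ with $F(\mathbf{x})\equiv 0\pmod{m^k}$ satisfies $\mathbf{x}\equiv\mathbf{0}\pmod m$. Let $R'\subseteq\{0,1,\dots,m^k-1\}$ be a set such that for all distinct $r,r'\in R'$, $r-r'$ is not congruent modulo $m^k$ to any element of $F(\mathbb{Z}^n)$. Let $\gamma=\frac{\log_m|R'|}{k}$. Then there is a constant $c>0$ depending only on $m$ and $k$ such that for every positive integer $N$ there exists a set $A\subseteq[N]$ with $(A-A)\cap F(\mathbb{Z}^n)=\{0\}$ and $|A|\geq cN^{\gamma}$.
   Context: $[N]=\{1,2,\dots,N\}$; $A-A=\{a-a':a,a'\in A\}$; $F(\mathbb{Z}^n)=\{F(\mathbf{x}):\mathbf{x}\in\mathbb{Z}^n\}$; $\mathbf{x}\equiv\mathbf{0}\pmod m$ means every coordinate is divisible by $m$. *)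

(* Defs.v *)
From mathcomp Require Import all_boot all_order all_algebra finmap.
From mathcomp Require Import boolp classical_sets reals exp.
From mathcomp Require Import mpoly.

Set Implicit Arguments.
Unset Strict Implicit.
Unset Printing Implicit Defensive.

Import Order.TTheory GRing.Theory Num.Theory.
Local Open Scope ring_scope.
Local Open Scope classical_set_scope.

Definition polyvalues (n : nat) (F : {mpoly int[n]}) : set int :=
  [set F.@[x] | x in [set: 'I_n -> int]].

Definition diffset (A : set int) : set int :=
  [set a - a' | a in A & a' in A].

(* As [ln] is 0 on nonpositive arguments, [logb b 0 = 0]. *)
Definition logb (R : realType) (b x : R) : R := ln x / ln b.

(* Main.v *)
Require Import Defs.
From mathcomp Require Import all_boot all_order all_algebra finmap.
From mathcomp Require Import boolp classical_sets reals exp.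
From mathcomp Require Import mpoly.
From mathcomp Require Import zify ring.

Set Implicit Arguments.
Unset Strict Implicit.
Unset Printing Implicit Defensive.

Import Order.TTheory GRing.Theory Num.Theory.
Local Open Scope ring_scope.
Local Open Scope classical_set_scope.

(** Take the numbers whose digits in base [m^k] all lie in [R']. If two distinct
    ones differ by [F x], then either their last digits differ, so that [F x] is
    congruent to a difference of distinct elements of [R'], or [m^k] divides
    [F x]; in the latter case [x = m y] and [F x = m^k F y], and deleting the
    common last digit gives two shorter numbers that differ by [F y]. There are
    [|R'|^L] such numbers with [L] digits, and we take
    [m^(kL) <= N < m^(k(L+1))]; thus [c = m^(-k)] works, since [|R'| <= m^k]. *)

Lemma meval_dhomogZ (A : comNzRingType) (n d : nat) (p : {mpoly A[n]}) (a : A)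
    (v : 'I_n -> A) :
  p \is d.-homog -> p.@[fun i => a * v i] = a ^+ d * p.@[v].
Proof.
move=> /dhomogP p_homog; rewrite !mevalE mulr_sumr.
rewrite big_seq [RHS]big_seq; apply: eq_bigr => e e_p.
rewrite -(p_homog e e_p) mulrCA; congr (_ * _).
rewrite /= mdegE -prodrXr -big_split/=.
by apply: eq_bigr => i _; rewrite exprMn.
Qed.

(** Scaling the argument by 0 gives [F(0) = 0^k F(0)], which vanishes because [k > 0]. *)
Lemma polyvalues_0 (n k : nat) (F : {mpoly int[n]}) :
  (0 < k)%N -> F \is k.-homog -> polyvalues F 0.
Proof.
move=> k_gt0 F_homog; exists (fun=> 0) => //.
have /= := meval_dhomogZ 0 (fun=> 0) F_homog.
by rewrite expr0n eqn0Ngt k_gt0 mul0r mul0r.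
Qed.

(** The descent step: [m] divides every coordinate of the argument, and by homogeneity dividing them
    all by [m] divides the value by [m^k]. *)
Lemma polyvalues_dvd (n k m : nat) (F : {mpoly int[n]}) (z : int) :
  (0 < m)%N -> F \is k.-homog ->
  (forall x : 'I_n -> int,
    (F.@[x] = 0 %[mod m%:Z ^+ k])%Z ->
    forall i : 'I_n, (x i = 0 %[mod m%:Z])%Z) ->
  polyvalues F (m%:Z ^+ k * z) -> polyvalues F z.
Proof.
move=> m_gt0 F_homog F_anis [x _ Fx].
have x_dvd i : (m%:Z %| x i)%Z.
  apply/dvdz_mod0P; rewrite F_anis ?mod0z// Fx.
  by apply/dvdz_mod0P/dvdz_mulr.
exists (fun i => (x i %/ m%:Z)%Z) => //.
have mk_neq0 : m%:Z ^+ k != 0 by rewrite expf_neq0//; lia.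
apply: (mulfI mk_neq0); rewrite -Fx -meval_dhomogZ//.
by apply: meval_eq => i; rewrite mulrC divzK.
Qed.

(** The last digit is outermost, so that induction on [L] strips exactly the digit that the descent
    removes. *)
Fixpoint digit_expansions (b : int) (D : seq int) (L : nat) : seq int :=
  if L is L'.+1 then
    [seq r + b * a | r <- D, a <- digit_expansions b D L']
  else [:: 0].

Section DigitExpansions.

Variables (b : int) (D : seq int).
Hypothesis D_range : forall r, r \in D -> 0 <= r < b.

Lemma size_digit_expansions L :
  size (digit_expansions b D L) = (size D ^ L)%N.
Proof. by elim: L => //= L IHL; rewrite size_allpairs IHL expnS. Qed.

Lemma digit_expansions_range L a :
  a \in digit_expansions b D L -> 0 <= a < b ^+ L.
Proof.
elim: L a => [|L IHL] a /=; first by rewrite inE => /eqP->.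
case/allpairsP => -[r t] /= [/D_range r_range /IHL t_range ->].
by rewrite exprS; nia.
Qed.

Lemma digit_expansions_uniq L : uniq D -> uniq (digit_expansions b D L).
Proof.
move=> D_uniq; elim: L => //= L IHL; apply: allpairs_uniq => //.
move=> _ _ /allpairsP[[r t] /= [/D_range r_range _ ->]]
  /allpairsP[[r' t'] /= [/D_range r'_range _ ->]] /= eq_rt.
(* [r - r'] is a multiple of [b] of absolute value less than [b], hence zero. *)
have eq_t : t = t' by nia.
by move: eq_rt; rewrite eq_t => /addIr->.
Qed.

End DigitExpansions.

Lemma digit_expansions_diff (n k m L : nat) (F : {mpoly int[n]})
    (D : seq int) (a a' : int) :
  (0 < m)%N -> F \is k.-homog ->
  (forall x : 'I_n -> int,
    (F.@[x] = 0 %[mod m%:Z ^+ k])%Z ->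
    forall i : 'I_n, (x i = 0 %[mod m%:Z])%Z) ->
  (forall r r' : int, r \in D -> r' \in D -> r <> r' ->
    forall z : int, polyvalues F z -> ~ (r - r' = z %[mod m%:Z ^+ k])%Z) ->
  a \in digit_expansions (m%:Z ^+ k) D L ->
  a' \in digit_expansions (m%:Z ^+ k) D L ->
  polyvalues F (a - a') -> a = a'.
Proof.
move=> m_gt0 F_homog F_anis D_diff.
elim: L a a' => [|L IHL] a a' /=; first by rewrite !inE => /eqP-> /eqP->.
case/allpairsP => -[r t] /= [rD tL ->].
case/allpairsP => -[r' t'] /= [r'D t'L ->].
have [<-|/eqP r_neq] := eqVneq r r'.
  rewrite [_ - _](_ : _ = m%:Z ^+ k * (t - t')); last by ring.
  by move=> /(polyvalues_dvd m_gt0 F_homog F_anis)/(IHL _ _ tL t'L)->.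
(* Modulo [m^k] the value [a - a'] of [F] is the difference of the last digits, which is
   excluded. *)
move=> /(D_diff _ _ rD r'D r_neq) [].
apply/eqP; rewrite eqz_mod_dvd.
rewrite [X in (_ %| X)%Z](_ : _ = m%:Z ^+ k * (t' - t)); last by ring.
exact: dvdz_mulr.
Qed.

Lemma card_int_range (b : nat) (D : {fset int}) :
  (forall r, r \in D -> 0 <= r < b%:Z) -> (#|` D| <= b)%N.
Proof.
move=> D_range; rewrite -(size_map absz) -(size_iota 0 b).
apply: uniq_leq_size.
  by rewrite map_inj_in_uniq ?fset_uniq// => r r' /D_range + /D_range; lia.
by move=> _ /mapP[r /D_range r_range ->]; rewrite mem_iota; lia.
Qed.

Lemma powR_logb (R : realType) (b x : R) : 1 < b -> 0 < x -> b `^ logb b x = x.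
Proof.
move=> b_gt1 x_gt0; have lnb_gt0 := ln_gt0 b_gt1.
rewrite /powR gt_eqF ?(lt_trans _ b_gt1)// /logb divfK ?gt_eqF//.
exact: lnK.
Qed.

Lemma diffset0 (A : set int) (a : int) : A a -> diffset A 0.
Proof. by move=> Aa; exists a => //; exists a => //; rewrite subrr. Qed.

(** The shift cancels in differences. With [t = 1] it moves expansions from [[0, m^(kL))] into
    [[1, N]]. *)
Lemma diffset_addl (t : int) (s : seq int) :
  diffset [set` [fset x in map (+%R t) s]%fset] `<=` diffset [set` s].
Proof.
move=> _ [b /= b_s [b' /= b'_s <-]]; move: b_s b'_s.
rewrite !inE => /mapP[a a_s ->] /mapP[a' a'_s ->].
by exists a => //; exists a' => //; ring.
Qed.

Theorem theorem1p7 (R : realType) (m k : nat) (hm : (2 <= m)%N)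
    (hk : (2 <= k)%N) :
  exists c : R, 0 < c /\
  forall (n : nat) (F : {mpoly int[n]}),
    F \is k.-homog ->
    (forall x : 'I_n -> int,
      (F.@[x] = 0 %[mod m%:Z ^+ k])%Z ->
      forall i : 'I_n, (x i = 0 %[mod m%:Z])%Z) ->
  forall R' : {fset int},
    (forall r : int, r \in R' -> 0 <= r < m%:Z ^+ k) ->
    (forall r r' : int, r \in R' -> r' \in R' -> r <> r' ->
      forall z : int, polyvalues F z ->
        ~ (r - r' = z %[mod m%:Z ^+ k])%Z) ->
  let gamma : R := logb m%:R (#|` R'|%fset)%:R / k%:R in
  forall N : nat, (0 < N)%N ->
  exists A : {fset int},
    [/\ forall a : int, a \in A -> 1 <= a <= N%:Z,
        diffset [set` A] `&` polyvalues F = [set 0]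
      & c * N%:R `^ gamma <= (#|` A|%fset)%:R].
Proof.
have m_gt0 : (0 < m)%N by lia.
have k_gt0 : (0 < k)%N by lia.
have M_gt0 : (0 < m ^ k)%N by rewrite expn_gt0 m_gt0.
exists (m ^ k)%:R^-1; split; first by rewrite invr_gt0 ltr0n.
move=> n F F_homog F_anis R' R'_range R'_diff gamma N N_gt0.
have F0 := polyvalues_0 k_gt0 F_homog.
have [R'0|R'_neq0] := eqVneq R' fset0.
  (* For empty [R'] the convention [ln 0 = 0] makes [gamma = 0], so the bound reads [c <= |A|] and a
     singleton suffices. *)
  exists [fset 1]%fset; split.
  - by move=> a; rewrite inE => /eqP->; lia.
  - apply/seteqP; split => z /=.
      by case=> -[a /= + [a' /= +]]; rewrite !inE => /eqP-> /eqP-> <-.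
    by move=> ->; split=> //; apply: (@diffset0 _ 1); rewrite /= inE.
  - rewrite /gamma R'0 cardfs0 /logb ln0// !mul0r powRr0 mulr1 cardfs1.
    by rewrite invf_le1 ?ltr0n// ler1n.
have R'_gt0 : (0 < #|` R'|)%N by rewrite cardfs_gt0.
set L := trunc_log (m ^ k) N.
have M_gt1 : (1 < m ^ k)%N by apply: leq_trans (leq_pexp2l m_gt0 k_gt0).
have /andP[L_le L_lt] := trunc_log_bounds M_gt1 N_gt0.
set s := digit_expansions (m%:Z ^+ k) R' L.
have s_uniq : uniq s by apply: digit_expansions_uniq => //; apply: fset_uniq.
have s_size : size s = (#|` R'| ^ L)%N by apply: size_digit_expansions.
exists [fset x in map (+%R 1) s]%fset; split.
- move=> a; rewrite !inE => /mapP[t /(digit_expansions_range R'_range)].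
  move=> t_range ->.
  have : (m%:Z ^+ k) ^+ L <= N%:Z by rewrite -!rmorphXn/= lez_nat.
  by lia.
- apply/seteqP; split => z /=.
    case=> /diffset_addl[a a_s [a' a'_s <-]] Faa'.
    suff -> : a = a' by rewrite subrr.
    exact: (digit_expansions_diff m_gt0 F_homog F_anis R'_diff a_s a'_s).
  move=> ->; split => //.
  (* The difference 0 occurs only if the set is nonempty; its size [|R'|^L] is positive. *)
  have [a a_s] : exists a, a \in s.
    by case: (s) s_size => [/eqP|a ? _]; [rewrite eq_sym expn_eq0; lia|
      exists a; rewrite mem_head].
  by apply: (@diffset0 _ (1 + a)); rewrite /= !inE map_f.
rewrite card_fseq undup_id; last by rewrite map_inj_uniq//; exact: addrI.
rewrite size_map s_size.
have R'_card : (#|` R'|%:R : R) = (m ^ k)%:R `^ gamma.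
  rewrite natrX -powR_mulrn ?ler0n// -powRrM mulrC divfK ?pnatr_eq0; last lia.
  by rewrite powR_logb ?ltr0n// ltr1n.
have R'_le : (#|` R'| <= m ^ k)%N.
  by apply: card_int_range => r /R'_range; rewrite rmorphXn.
(* This makes [x^gamma] monotone in [x], so that [N < m^(k(L+1))] can be raised to the power
   [gamma]. *)
have gamma_ge0 : 0 <= gamma.
  by rewrite divr_ge0// divr_ge0// ln_ge0// ler1n; lia.
(* The chain is [N^gamma <= (m^(k(L+1)))^gamma = |R'|^(L+1) <= |R'|^L m^k]. *)
rewrite mulrC ler_pdivrMr ?ltr0n//.
apply: (@le_trans _ _ (#|` R'| ^ L.+1)%:R); last first.
  by rewrite -natrM ler_nat expnSr leq_mul2l R'_le orbT.
rewrite natrX R'_card -powR_mulrn ?powR_ge0// powRAC powR_mulrn//.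
by rewrite ge0_ler_powR ?nnegrE ?exprn_ge0// -natrX ler_nat ltnW.
Qed.
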